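(* Let $p$ be an odd prime, $F$ the finite field of order $p^n$, $L$ its quadratic extension, and $s$ a nondegenerate invertible exponent over $L$ with $s\equiv 1\pmod{p^n-1}$. Then: (1) for every $a\in L$, $W_{L,s}(a)\ge -p^n$; (2) for every $a\in F$, $W_{L,s}(a)\ge 0$; (3) $W_{L,s}(1)\ge p^n$, and if moreover $p^n\equiv 2\pmod 3$, then $W_{L,s}(1)\ge 3p^n$.
   Context: $\mu(x)=e^{2\pi i\,\mathrm{Tr}_{L/\mathbb{F}_p}(x)/p}$ is the canonical additive character of $L$ and $W_{L,s}(a)=\sum_{x\in L}\mu(x^s-ax)$ (a real number). The exponent $s$ is invertible over $L$ if $\gcd(s,p^{2n}-1)=1$, and nondegenerate if it is not congruent to a power of $p$ modulo $p^{2n}-1$. *)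

(* Defs.v *)
From mathcomp Require Import all_boot all_order all_algebra all_field.
From mathcomp Require Import complex.
From mathcomp Require Import reals trigo.

Set Implicit Arguments.
Unset Strict Implicit.
Unset Printing Implicit Defensive.

Import Order.TTheory GRing.Theory Num.Theory.

Local Open Scope ring_scope.

(* e^{i t} *)
Definition expi (R : realType) (t : R) : R[i] := (cos t +i* sin t)%C.

(* A finite field of characteristic p is a finite-dimensional field extension L
   of 'F_p. The alias [finvect_type L] of L carries the canonical finType (so
   that one can sum over L) and splittingFieldType 'F_p structures. *)
Section WeilSum.

Variables (p : nat) (L : fieldExtType 'F_p).
Local Notation fL := (finvect_type L).

(* [galTrace 1 {:L} x] is the trace of x, as an element of L lying in its prime
   subfield; [absTrace x] is the corresponding element of 'F_p (see absTraceP). *)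
Definition absTrace (x : fL) : 'F_p :=
  odflt 0 [pick k : 'F_p | k%:A == galTrace 1%AS {:fL}%AS x].

Lemma absTraceP (x : fL) : (absTrace x)%:A = galTrace 1%AS {:fL}%AS x.
Proof.
rewrite /absTrace; case: pickP => [k /eqP //|no_k].
have gal1 : galois 1%AS {:fL}%AS by apply: finField_galois; apply: subvf.
have /vlineP[k Dk] := mem_galTrace gal1 (memvf x).
by have := no_k k; rewrite Dk eqxx.
Qed.

Definition addChar (R : realType) (x : fL) : R[i] :=
  expi (2 * pi * (absTrace x : nat)%:R / p%:R).

Definition WeilSum (R : realType) (s : nat) (a : fL) : R[i] :=
  \sum_(x : fL) addChar R (x ^+ s - a * x).

End WeilSum.

Definition invertible_exponent (p m s : nat) : Prop :=
  coprime s (p ^ m - 1).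

Definition nondegenerate_exponent (p m s : nat) : Prop :=
  forall k : nat, s <> p ^ k %[mod p ^ m - 1].

(* Main.v *)
Require Import Defs.
From mathcomp Require Import all_boot all_order all_fingroup all_algebra all_solvable all_field.
From mathcomp Require Import complex.
From mathcomp Require Import reals trigo.
From mathcomp Require Import zify.

Import Order.TTheory GRing.Theory Num.Theory.

Local Open Scope ring_scope.

(** Let q = p^n and let mu be the additive character of L. Since s = 1 mod q-1,
    we have (r x)^s = r x^s for r in F. Averaging the Weil sum over the
    substitutions x -> r x with r in F* therefore gives
      (q-1) W(a) + q^2 = \sum_x \sum_(r in F) mu(r (x^s - a x)).
    Each inner sum is a character sum over the group F, hence nonnegative, and
    equals q when the relative trace of x^s - a x vanishes. The set of such x
    is stable under F*, so k nonzero solutions that are pairwise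
    non-proportional over F yield W(a) >= (k-1) q. Taking k = 0 gives (1). An
    element v with v^q = -v is a solution for each a in F, which gives (2). For
    a = 1 there is also the solution 1, and, if q = 2 mod 3, the two primitive
    cube roots of unity, because the power s either fixes or exchanges them. *)

(** * Averaged Weil sums for an abstract additive character *)

Section NihoSum.

Set Implicit Arguments.
Unset Strict Implicit.

Variables (E : finFieldType) (C : numDomainType) (chi : E -> C) (q s : nat).

Hypothesis pchar_q : [pchar E].-nat q.
Hypothesis odd_q : odd q.
Hypothesis card_E : #|E| = (q ^ 2)%N.

Definition Fq : {set E} := [set x | x ^+ q == x].

Hypothesis card_Fq : #|Fq| = q.
Hypothesis chiD : forall x y, chi (x + y) = chi x * chi y.
(* z ^+ q = - z says that the relative trace z + z ^+ q vanishes. *)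
Hypothesis chi1 : forall z, z ^+ q = - z -> chi z = 1.
Hypothesis coprime_s : coprime s (q ^ 2 - 1).
Hypothesis s_Niho : s = 1 %[mod q - 1].

Local Notation weil a := (\sum_x chi (x ^+ s - a * x)).

Lemma FqP x : reflect (x ^+ q = x) (x \in Fq).
Proof. by rewrite inE; apply: eqP. Qed.

Lemma q_gt2 : (2 < q)%N.
Proof.
have : (1 < q ^ 2)%N by rewrite -card_E finNzRing_gt1.
by case: q odd_q => [|[|[|m]]].
Qed.

Lemma q_gt0 : (0 < q)%N. Proof. exact: leq_trans q_gt2. Qed.

Lemma exprDq (x y : E) : (x + y) ^+ q = x ^+ q + y ^+ q.
Proof. exact: exprDn_pchar. Qed.

Lemma exprNq (x : E) : (- x) ^+ q = - x ^+ q.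
Proof. by rewrite exprNn -signr_odd odd_q mulN1r. Qed.

Lemma s_gt0 : (0 < s)%N.
Proof.
rewrite lt0n; apply/eqP => s0.
move: coprime_s; rewrite s0 /coprime gcd0n => /eqP.
by have := q_gt2; case: q => [|[|[|m]]] // _; lia.
Qed.

(** As [q - 1] divides [s - 1], the factor in front of [x] is a power of [x ^+ q.-1], which
    collapses to 1 when [x] is a nonzero element of [Fq]. *)
Lemma expr_s (x : E) : exists t, x ^+ s = (x ^+ q.-1) ^+ t * x.
Proof.
have : (q - 1 %| s - 1)%N by rewrite -eqn_mod_dvd ?s_gt0 //; apply/eqP.
case/dvdnP => t Dt; exists t.
rewrite -exprM -exprSr; congr (_ ^+ _).
by have := s_gt0; lia.
Qed.

Lemma expr_pred_q (x : E) : x != 0 -> (x ^+ q.-1) * x = x ^+ q.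
Proof. by rewrite -exprSr prednK // q_gt0. Qed.

Lemma Fq_expr_pred r : r \in Fq -> r != 0 -> r ^+ q.-1 = 1.
Proof.
by move=> /FqP rq r0; apply: (mulIf r0); rewrite expr_pred_q // mul1r.
Qed.

Lemma Fq_expr_s r : r \in Fq -> r ^+ s = r.
Proof.
case: (eqVneq r 0) => [->|r0 Fr]; first by rewrite expr0n gtn_eqF ?s_gt0.
by have [t ->] := expr_s r; rewrite Fq_expr_pred // expr1n mul1r.
Qed.

Lemma chi_0 : chi 0 = 1.
Proof. by apply: chi1; rewrite expr0n gtn_eqF ?q_gt0 ?oppr0. Qed.

Lemma Fq0 : 0 \in Fq.
Proof. by apply/FqP; rewrite expr0n gtn_eqF ?q_gt0. Qed.

Lemma card_Fq_nz : #|Fq :\ 0| = q.-1.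
Proof. by rewrite -[in RHS]card_Fq (cardsD1 0 Fq) Fq0. Qed.

Lemma Fq1 : 1 \in Fq.
Proof. by apply/FqP; rewrite expr1n. Qed.

(** Orthogonality: if [chi (r0 * z)] differs from 1, translation by [r0] multiplies the sum by that
    value, so the sum is 0; otherwise every term is 1. *)
Lemma sum_chi_Fq_ge0 z : 0 <= \sum_(r in Fq) chi (r * z).
Proof.
have [/forall_inP all1|] := boolP [forall (r | r \in Fq), chi (r * z) == 1].
  by apply: sumr_ge0 => r /all1/eqP ->; apply: ler01.
rewrite negb_forall_in => /exists_inP[r0 /FqP r0F chi_r0].
have shift : chi (r0 * z) * (\sum_(r in Fq) chi (r * z))
           = \sum_(r in Fq) chi (r * z).
  rewrite mulr_sumr [RHS](reindex_inj (addrI r0)) /=.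
  apply: eq_big => [r|r _]; last by rewrite mulrDl chiD.
  by rewrite !inE exprDq r0F (inj_eq (addrI r0)).
move/eqP: shift; rewrite -subr_eq0 -[X in _ - X]mul1r -mulrBl mulf_eq0.
by rewrite subr_eq0 (negPf chi_r0) /= => /eqP ->.
Qed.

Lemma sum_chi_Fq_tr0 z : z ^+ q = - z -> \sum_(r in Fq) chi (r * z) = q%:R.
Proof.
move=> zq; rewrite (eq_bigr (fun=> 1)) ?sumr_const ?card_Fq // => r /FqP rq.
by apply: chi1; rewrite exprMn rq zq mulrN.
Qed.

Lemma weil_double_sum a :
  (q.-1)%:R * weil a + (q ^ 2)%:R =
    \sum_x \sum_(r in Fq) chi (r * (x ^+ s - a * x)).
Proof.
(* The term [r = 0] accounts for [q ^ 2]; each of the [q.-1] others equals [weil a]. *)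
rewrite exchange_big [RHS](bigD1 0) ?Fq0 //= [RHS]addrC; congr (_ + _); last first.
  rewrite (eq_bigr (fun=> 1)) => [|x _]; last by rewrite mul0r chi_0.
  by rewrite sumr_const cardT -cardE card_E.
rewrite [RHS](eq_bigr (fun=> weil a)) => [|r /andP[Fr r0]].
  rewrite sumr_const -[RHS]mulr_natl; congr (_%:R * _).
  rewrite -card_Fq_nz; apply: eq_card => x.
  by rewrite [x \in Fq :\ 0]inE in_set1 andbC.
rewrite [RHS](reindex_inj (mulfI r0)) /=; apply: eq_bigr => x _.
by rewrite exprMn (Fq_expr_s Fr) mulrBr mulrCA.
Qed.

(** * Zeros of the relative trace and the resulting lower bound *)

Definition zeros a : {set E} :=
  [set x | (x ^+ s - a * x) ^+ q == - (x ^+ s - a * x)].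

Lemma card_zeros_bound a : (q * #|zeros a|)%:R <= q.-1%:R * weil a + (q ^ 2)%:R.
Proof.
rewrite weil_double_sum (bigID (mem (zeros a))) /=.
rewrite (eq_bigr (fun=> q%:R)) => [|x]; last first.
  by rewrite inE => /eqP/sum_chi_Fq_tr0.
rewrite sumr_const natrM mulr_natr lerDl.
by apply: sumr_ge0 => x _; apply: sum_chi_Fq_ge0.
Qed.

Lemma zerosZ a r x : r \in Fq -> x \in zeros a -> r * x \in zeros a.
Proof.
move=> Fr; rewrite !inE => /eqP Zx; have /FqP rq := Fr.
rewrite exprMn (Fq_expr_s Fr) mulrCA -mulrBr exprMn rq Zx mulrN; exact: eqxx.
Qed.

Lemma zeros0 a : 0 \in zeros a.
Proof.
by rewrite inE expr0n gtn_eqF ?s_gt0 // mulr0 subr0 expr0n gtn_eqF ?q_gt0 ?oppr0.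
Qed.

(* x ^+ q.-1 classifies x modulo the nonzero elements of Fq. *)
Lemma size_zeros a (vs : seq E) :
  {subset vs <= zeros a} -> 0 \notin vs -> uniq [seq v ^+ q.-1 | v <- vs] ->
  (size vs * q.-1 + 1 <= #|zeros a|)%N.
Proof.
move=> vsZ vs0 uniq_vs.
rewrite (cardsD1 0) zeros0 addnC leq_add2l.
have <- : #|setX [set v in vs] (Fq :\ 0)| = (size vs * q.-1)%N.
  rewrite cardsX cardsE (card_uniqP _) ?(map_uniq uniq_vs) //.
  by rewrite card_Fq_nz.
have inj_vs : {in vs &, injective (fun v : E => v ^+ q.-1)}.
  move=> v w v_vs w_vs /= eq_vw; apply/eqP.
  rewrite -(nth_index 0 v_vs) -(nth_index 0 w_vs) nth_uniq ?index_mem //.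
    rewrite -(nth_uniq 0 _ _ uniq_vs) ?size_map ?index_mem //.
    by rewrite !(nth_map 0) ?index_mem // !nth_index // eq_vw.
  exact: map_uniq uniq_vs.
(* The power [q.-1] kills the scalar [r], so it recovers [v] from [r * v]; cancelling [v] then
   recovers [r]. *)
have inj : {in setX [set v in vs] (Fq :\ 0) &, injective (fun u : E * E => u.2 * u.1)}.
  move=> [v r] [v' r'] /setXP[/=]; rewrite inE => vv /setD1P[r0 Fr].
  move=> /setXP[/=]; rewrite inE => vv' /setD1P[r0' Fr'] eq_rv.
  have eqv : v = v'.
    have := congr1 (fun x => x ^+ q.-1) eq_rv.
    rewrite /= !exprMn (Fq_expr_pred Fr r0) (Fq_expr_pred Fr' r0') !mul1r.
    by move/(inj_vs _ _ vv vv').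
  move: eq_rv; rewrite /= eqv => /mulIf ->//.
  by apply: contraNneq vs0 => <-.
rewrite -(card_in_imset inj); apply/subset_leq_card/subsetP => x /imsetP[[v r] vr ->{x}].
case/setXP: vr; rewrite inE /= => vv /setD1P[r0 Fr] {inj}.
rewrite !inE mulf_neq0 ?r0 //=; last by apply: contraNneq vs0 => <-.
by have := zerosZ Fr (vsZ _ vv); rewrite inE.
Qed.

Lemma weil_ge a (vs : seq E) :
  {subset vs <= zeros a} -> 0 \notin vs -> uniq [seq v ^+ q.-1 | v <- vs] ->
  (size vs * q)%:R <= weil a + q%:R.
Proof.
move=> vsZ vs0 uniq_vs; have szZ := size_zeros vsZ vs0 uniq_vs.
have q1_gt0 : 0 < q.-1%:R :> C by rewrite ltr0n; have := q_gt2; lia.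
(* Scaling by [q.-1] and adding [q] turns the left side into [q * (size vs * q.-1 + 1)], at most
   [q * #|zeros a|]. *)
rewrite -(ler_pM2l q1_gt0) mulrDr -(lerD2r q%:R) -addrA -!natrM -!natrD.
have -> : (q.-1 * q + q = q ^ 2)%N by have := q_gt0; nia.
apply: le_trans (card_zeros_bound a); rewrite ler_nat.
by have := leq_mul (leqnn q) szZ; nia.
Qed.

Lemma weil_geN a : - q%:R <= weil a.
Proof.
by rewrite -subr_ge0 opprK; apply: (@weil_ge a [::]).
Qed.

Lemma exists_antifixed : exists2 v : E, v != 0 & v ^+ q = - v.
Proof.
have [y yF] : exists y, y \notin Fq.
  apply/existsP; rewrite -negb_forall; apply/negP => /forallP allF.
  have : #|Fq| = #|E| by apply: eq_card => x; rewrite allF.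
  by rewrite card_Fq card_E; have := q_gt2; nia.
(* The power [q] swaps [y] and [y ^+ q], because [y ^+ (q ^ 2) = y] in [E]. *)
exists (y - y ^+ q); first by rewrite subr_eq0 eq_sym; move: yF; rewrite inE.
by rewrite exprDq exprNq -exprM mulnn -card_E expf_card opprB addrC.
Qed.

(** The powers [q] and [s] commute, so membership can be tested as soon as [x ^+ q] is known
    explicitly. *)
Lemma mem_zeros a x :
  (x \in zeros a) = ((x ^+ q) ^+ s - a ^+ q * x ^+ q == a * x - x ^+ s).
Proof. by rewrite inE exprDq exprNq exprMn opprB -!exprM mulnC. Qed.

(** [s] is coprime to [q ^ 2 - 1], which is even. *)
Lemma odd_s : odd s.
Proof.
have s2 : ~~ (2 %| s)%N.
  apply/negP => s2; have : (2 %| gcdn s (q ^ 2 - 1))%N.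
    rewrite dvdn_gcd s2 dvdn2 oddB ?expn_gt0 ?q_gt0 //.
    by rewrite oddX odd_q.
  by rewrite (eqP coprime_s).
by rewrite dvdn2 negbK in s2.
Qed.

Lemma antifixed_zero a v : a \in Fq -> v ^+ q = - v -> v \in zeros a.
Proof.
move=> /FqP aq vq; rewrite mem_zeros vq aq exprNn -signr_odd odd_s.
by rewrite mulN1r mulrN opprK addrC.
Qed.

Lemma antifixed_expr_pred (v : E) : v != 0 -> v ^+ q = - v -> v ^+ q.-1 = -1.
Proof.
by move=> v0 vq; apply: (mulIf v0); rewrite expr_pred_q // mulN1r.
Qed.

Lemma one_zero : (1 : E) \in zeros 1.
Proof. by rewrite mem_zeros !expr1n mul1r !subrr. Qed.

Lemma N1_neq1 : -1 != 1 :> E.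
Proof.
rewrite eq_sym -subr_eq0 opprK -mulr2n; apply/negP => char2.
have {char2} pchar2 : 2%N \in [pchar E] by rewrite inE.
have [m qE] : {m | q = (2 ^ m)%N}.
  by apply/p_natP; rewrite -(eq_pnat _ (pcharf_eq pchar2)).
(* An odd power of 2 is 1, against [2 < q]. *)
by move: odd_q q_gt2; rewrite qE oddX orbF => /eqP ->.
Qed.

Lemma weil_Fq_ge0 a : a \in Fq -> 0 <= weil a.
Proof.
move=> Fa; have [v v0 vq] := exists_antifixed.
have /= := @weil_ge a [:: v]; rewrite mul1n -lerBlDr subrr; apply=> //.
  by move=> x; rewrite mem_seq1 => /eqP ->; apply: antifixed_zero.
by rewrite inE eq_sym.
Qed.

Lemma weil1_ge : q%:R <= weil 1.
Proof.
have [v v0 vq] := exists_antifixed.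
have /= := @weil_ge 1 [:: 1; v].
rewrite mulSn mul1n natrD lerD2r; apply.
- move=> x; rewrite !in_cons in_nil orbF => /orP[] /eqP ->; rewrite ?one_zero //.
  exact: antifixed_zero Fq1 vq.
- by rewrite !inE !negb_or eq_sym oner_eq0 eq_sym.
(* The classes of [1] and [v] are [1] and [-1]. *)
by rewrite /= inE andbT expr1n antifixed_expr_pred // eq_sym N1_neq1.
Qed.

(** * Two further zeros when [q] is 2 modulo 3 *)

Section CubeRoots.

Hypothesis q_mod3 : q = 2 %[mod 3].

(** Cauchy's theorem applies to the unit group, since 3 divides [q + 1] and hence [q ^ 2 - 1]. *)
Lemma exists_cube_root : exists2 w : E, w != 1 & w ^+ 3 = 1.
Proof.
have div3 : (3 %| #|[set: {unit E}]|)%N.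
  rewrite card_finField_unit card_E.
  rewrite -subn1 -[1%N]/(1 ^ 2)%N subn_sqr dvdn_mull //.
  by apply/eqP; rewrite -modnDml q_mod3.
have [//|u _ ord_u] := Cauchy _ div3.
exists (val u); last by rewrite -FinRing.val_unitX -ord_u expg_order.
apply/eqP => u1; have : u = 1%g by apply: val_inj.
by move=> uE; rewrite uE order1 in ord_u.
Qed.

(** Here [w ^+ q = w ^+ 2], and 3 does not divide [s]. Both sides of [mem_zeros] are 0 if [s] is 1
    modulo 3, and [w - w ^+ 2] if [s] is 2 modulo 3. *)
Lemma cube_root_zero (w : E) : w ^+ 3 = 1 -> w \in zeros 1.
Proof.
move=> w3; rewrite mem_zeros expr1n !mul1r.
rewrite -(expr_mod q w3) q_mod3 -exprM -(expr_mod s w3) -(expr_mod (_ * s) w3).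
rewrite -modnMmr.
have : ((s %% 3 == 1) || (s %% 3 == 2))%N.
  have : ~~ (3 %| s)%N.
    apply/negP => s3; have : (3 %| gcdn s (q ^ 2 - 1))%N.
      rewrite dvdn_gcd s3 -[1%N]/(1 ^ 2)%N subn_sqr dvdn_mull //.
      by apply/eqP; rewrite -modnDml q_mod3.
    by rewrite (eqP coprime_s).
  by lia.
by case/orP => /eqP ->; rewrite ?subrr.
Qed.

Lemma weil1_ge3 : (3 * q)%:R <= weil 1.
Proof.
have [v v0 vq] := exists_antifixed; have [w w1 w3] := exists_cube_root.
have w0 : w != 0 by apply: contra_eq_neq w3 => ->; rewrite expr0n eq_sym oner_eq0.
have wN1 : w != -1.
  apply: contra_eq_neq w3 => ->.
  by rewrite -signr_odd N1_neq1.
have w2N1 : w ^+ 2 != -1.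
  apply: contra_neq wN1 => w2.
  by apply: oppr_inj; rewrite opprK -w3 exprS w2 mulrN1.
have w2n1 : w ^+ 2 != 1.
  by apply: contra_neq w1 => w2; rewrite -w3 exprS w2 mulr1.
have w2w : w ^+ 2 != w.
  by apply: contra_neq w1 => w2; apply: (mulfI w0); rewrite mulr1 -expr2.
(* Hence [w] and [w ^+ 2] are their own classes, and the four classes to separate are [1], [-1], [w]
   and [w ^+ 2]. *)
have q1 : q.-1 = 1 %[mod 3] by have := q_gt2; lia.
have /= := @weil_ge 1 [:: 1; v; w; w ^+ 2].
rewrite (mulSn 3) addnC natrD lerD2r; apply.
- move=> x; rewrite !in_cons in_nil orbF => /or4P[] /eqP ->; rewrite ?one_zero //.
  + exact: antifixed_zero Fq1 vq.
  + exact: cube_root_zero.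
  + by apply: cube_root_zero; rewrite exprAC w3 expr1n.
- by rewrite !inE !negb_or eq_sym oner_eq0 !(eq_sym 0) v0 w0 expf_neq0.
rewrite /= !inE expr1n antifixed_expr_pred // exprAC.
rewrite -(expr_mod q.-1 w3) q1 expr1 !negb_or !(eq_sym _ w) !(eq_sym _ (w ^+ 2)).
by rewrite eq_sym N1_neq1 w1 wN1 w2n1 w2N1 w2w.
Qed.

End CubeRoots.

End NihoSum.

(** * The canonical additive character of [L] *)

Section AdditiveCharacter.

Variables (R : realType) (p : nat) (L : fieldExtType 'F_p).

Local Notation fL := (finvect_type L).

Hypothesis p_prime : prime p.

Lemma expiD (t u : R) : expi (t + u) = expi t * expi u.
Proof. by rewrite /expi cosD sinD /GRing.mul /= addrC [X in (_ +i* X)%C]addrC. Qed.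

Lemma expiMn (t : R) k : expi (t *+ k) = expi t ^+ k.
Proof.
elim: k => [|k IHk]; first by rewrite mulr0n /expi cos0 sin0.
by rewrite mulrS expiD IHk exprS.
Qed.

Lemma absTraceD : {morph (@absTrace p L) : x y / x + y}.
Proof.
move=> x y; apply: (fmorph_inj (in_alg fL)).
by rewrite rmorphD /= !absTraceP raddfD.
Qed.

Lemma addCharE (x : fL) :
  addChar R x = expi (2 * pi / p%:R) ^+ (absTrace x : nat).
Proof.
by rewrite /addChar -expiMn -[X in _ = expi X]mulr_natr mulrAC.
Qed.

Lemma addCharD (x y : fL) : addChar R (x + y) = addChar R x * addChar R y.
Proof.
have zp : expi (2 * pi / p%:R : R) ^+ p = 1.
  rewrite -expiMn -[_ *+ p]mulr_natr divfK ?pnatr_eq0 -?lt0n ?prime_gt0 //.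
  by rewrite mulr_natl /expi cos2pi sin2pi.
(* Addition in ['F_p] reduces representatives modulo [p], which a [p]-th root of unity does not
   see. *)
rewrite !addCharE -exprD absTraceD /= expr_mod //.
by rewrite Fp_cast.
Qed.

(** The power [#|F|] is the Frobenius generator of the Galois group over [F], a subgroup of the one
    over the prime field, and the trace is Galois invariant. *)
Lemma absTraceX_card (F : {subfield fL}) (x : fL) :
  absTrace (x ^+ #|F|) = absTrace x.
Proof.
apply: (fmorph_inj (in_alg fL)); rewrite /= !absTraceP.
have [alpha gen_alpha alphaE] := finField_galois_generator (subvf F).
rewrite card_vspace -alphaE ?memvf // galTrace_gal ?memvf //.
apply: subsetP (galS _ (sub1v F)) _ _.
by rewrite (eqP gen_alpha) cycle_id.
Qed.

(** Invariance gives [absTrace x = - absTrace x], so the trace vanishes as [p] is odd. This supplies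
    the hypothesis [chi1]. *)
Lemma addChar_antifixed (F : {subfield fL}) (x : fL) :
  odd p -> x ^+ #|F| = - x -> addChar R x = 1.
Proof.
move=> odd_p xF; have := absTraceX_card F x.
have tr0 : absTrace (0 : fL) = 0.
  by apply: (addrI (absTrace (0 : fL))); rewrite -absTraceD !addr0.
rewrite xF => trN.
have : absTrace x *+ 2 = 0.
  by rewrite mulr2n -{1}trN -absTraceD addNr.
move=> /eqP; rewrite -mulr_natr mulf_eq0 => /orP[/eqP tx|].
  by rewrite addCharE tx.
rewrite -(dvdn_pcharf (pchar_Fp p_prime)) => /dvdn_leq -/(_ isT) p_le2.
have p2 : p = 2%N by apply/eqP; rewrite eqn_leq p_le2 prime_gt1.
by rewrite p2 in odd_p.
Qed.

End AdditiveCharacter.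

(** * Transfer to [L] and [F] *)

Theorem theorem3p6 (R : realType) (p n s : nat)
    (L : fieldExtType 'F_p) (F : {subfield L}) :
  prime p -> odd p ->
  #|(F : {vspace finvect_type L})| = (p ^ n)%N ->
  \dim_F {:L} = 2%N ->
  invertible_exponent p (2 * n) s ->
  nondegenerate_exponent p (2 * n) s ->
  s = 1 %[mod p ^ n - 1] ->
  [/\ (forall a : finvect_type L, - (p ^ n)%:R <= WeilSum R s a),
      (forall a : finvect_type L, a \in F -> 0 <= WeilSum R s a)
    & (p ^ n)%:R <= WeilSum R s (1 : finvect_type L) /\
      (p ^ n = 2 %[mod 3] ->
       3 * (p ^ n)%:R <= WeilSum R s (1 : finvect_type L))].
Proof.
move=> p_prime odd_p cardF dimFL; rewrite /invertible_exponent mulnC expnM.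
set q := (p ^ n)%N => inv_s _ s1.
pose F' : {subfield finvect_type L} := F.
have cardF' : #|F'| = q by [].
(* A finite field of order [q] is the set of roots of [x ^+ q = x], which identifies [F] with the
   abstract [Fq]. *)
have memF (x : finvect_type L) : (x \in F) = (x \in Fq (finvect_type L) q).
  by rewrite inE -cardF' card_vspace; apply: (Fermat's_little_theorem F').
have card_Fq : #|Fq (finvect_type L) q| = q.
  by rewrite -[RHS]cardF; apply: eq_card => x; rewrite -memF.
have card_L : #|finvect_type L| = (q ^ 2)%N.
  transitivity #|{:finvect_type L}%VS|; first by apply: eq_card => x; rewrite memvf.
  rewrite card_vspace (dim_sup_field (subvf F')) (dimFL : \dim_F' {:_} = 2%N).
  by rewrite mulnC expnM -cardF' card_vspace.
have odd_q : odd q by rewrite oddX odd_p orbT.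
have pchar_q : [pchar finvect_type L].-nat q.
  have pcharL : p \in [pchar finvect_type L].
    by rewrite (fmorph_pchar (in_alg (finvect_type L))) pchar_Fp.
  by rewrite pnatX (eq_pnat _ (pcharf_eq pcharL)) pnat_id.
have chi1 (z : finvect_type L) : z ^+ q = - z -> addChar R z = 1.
  by rewrite -cardF'; apply: addChar_antifixed.
have chiD := @addCharD R p L p_prime.
split=> [a|a|].
- exact: weil_geN.
- by rewrite memF; apply: weil_Fq_ge0.
split=> [|q2]; first exact: weil1_ge.
by rewrite -natrM; apply: weil1_ge3.
Qed.
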